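(* Let $a,b,c,d$ be real numbers with $b<0<a$ and $d<0<c$, and let $A,C,D,E,F$, the conics $Q_B$ ($B\in\mathbb{R}$), the function $\mathcal{A}$ and the cubic $$p(B)=FB^3-4DEB^2+(3CD^2+3AE^2-ACF)B-2ACDE$$ be as defined in the context. Let $\varepsilon\in\{+1,-1\}$. (i) If the conic $Q_{\varepsilon\sqrt{AC}}$ is a parabola, then $p$ has a root $B_\varepsilon$ with $\varepsilon B_\varepsilon>\sqrt{AC}$, the conic $Q_{B_\varepsilon}$ is a hyperbola, and $\mathcal{A}$ has a local maximum at $B_\varepsilon$. (ii) $B=\varepsilon\sqrt{AC}$ is a root of $p$ if and only if the conic $Q_{\varepsilon\sqrt{AC}}$ is a pair of parallel lines.
   Context: Put $A=cd$, $C=ab$, $D=-\tfrac12 cd(a+b)$, $E=-\tfrac12 ab(c+d)$, $F=abcd$ (so $A,C<0$ and $AC>0$). For $B\in\mathbb{R}$ let $Q_B$ be the conic $Ax^2+2Bxy+Cy^2+2Dx+2Ey+F=0$ in $\mathbb{R}^2$; it passes through $(a,0),(b,0),(0,c),(0,d)$. Let $$\mathbf{M}(B)=\begin{pmatrix} A & B & D \\ B & C & E \\ D & E & F \end{pmatrix}.$$ Define, for $B^2\neq AC$, $$\mathcal{A}(B)=\begin{cases}\dfrac{\det\mathbf{M}(B)}{(AC-B^2)^{3/2}}& B^2<AC,\\[2mm] \dfrac{-\det\mathbf{M}(B)}{(B^2-AC)^{3/2}}& B^2>AC,\end{cases}$$ with positive values of the powers in the denominators. ''Hyperbola'' and ''parabola''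 mean nondegenerate conics. *)

(* Defs.v *)
From HB Require Import structures.
From mathcomp Require Import all_boot all_order all_algebra.
From mathcomp Require Import all_classical all_reals all_analysis.
Set Implicit Arguments.
Unset Strict Implicit.
Unset Printing Implicit Defensive.
Import Order.TTheory GRing.Theory Num.Theory.
Import numFieldNormedType.Exports.
Local Open Scope classical_set_scope.
Local Open Scope ring_scope.

Section PlaneCurves.
Variable R : realType.
Implicit Type S : set (R * R).

(* In some direct orthonormal coordinate system (X, Y), with origin o and
   first axis directed by the unit vector (u, v), S has the standard equation
   (X / s) ^ 2 - (Y / t) ^ 2 = 1; in particular it is nondegenerate.  Indirect
   systems add nothing, the equation being even in Y. *)
Definition is_hyperbola S : Prop :=
  exists (o : R * R) (u v s t : R),
    [/\ u ^+ 2 + v ^+ 2 = 1, 0 < s, 0 < t &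
      S = [set z | ((u * (z.1 - o.1) + v * (z.2 - o.2)) / s) ^+ 2
                 - ((u * (z.2 - o.2) - v * (z.1 - o.1)) / t) ^+ 2 = 1]].

(* Same as above with the standard equation Y ^ 2 = 4 k X. *)
Definition is_parabola S : Prop :=
  exists (o : R * R) (u v k : R),
    [/\ u ^+ 2 + v ^+ 2 = 1, 0 < k &
      S = [set z | (u * (z.2 - o.2) - v * (z.1 - o.1)) ^+ 2
                 = 4 * k * (u * (z.1 - o.1) + v * (z.2 - o.2))]].

Definition line (u v w : R) : set (R * R) := [set z | u * z.1 + v * z.2 = w].

(* Two distinct parallel lines can be given a common normal vector (u, v). *)
Definition is_parallel_line_pair S : Prop :=
  exists u v w1 w2 : R,
    [/\ (u, v) != (0, 0), w1 != w2 & S = line u v w1 `|` line u v w2].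

Definition local_max_on (dom : set R) (f : R -> R) (x : R) : Prop :=
  dom x /\ \forall y \near within dom (nbhs x), f y <= f x.

End PlaneCurves.

Section Pencil.
Variables (R : realType) (a b c d : R).

Definition cfA : R := c * d.
Definition cfC : R := a * b.
Definition cfD : R := - 2^-1 * (c * d) * (a + b).
Definition cfE : R := - 2^-1 * (a * b) * (c + d).
Definition cfF : R := a * b * c * d.

End Pencil.

Section PencilConics.
Variables (R : realType) (a b c d : R).
Local Notation A := (cfA c d).
Local Notation C := (cfC a b).
Local Notation D := (cfD a b c d).
Local Notation E := (cfE a b c d).
Local Notation F := (cfF a b c d).

Definition conic (B : R) : set (R * R) :=
  [set z | A * z.1 ^+ 2 + 2 * B * z.1 * z.2 + C * z.2 ^+ 2
           + 2 * D * z.1 + 2 * E * z.2 + F = 0].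

Definition conic_mx (B : R) : 'M[R]_3 :=
  \matrix_(i, j) nth 0 (nth [::] [:: [:: A; B; D];
                                   [:: B; C; E];
                                   [:: D; E; F]] i) j.

Definition calA_dom : set R := [set B | B ^+ 2 != A * C].

(* Only meaningful on calA_dom: the value at B ^+ 2 = A * C is junk. *)
Definition calA (B : R) : R :=
  if B ^+ 2 < A * C then \det (conic_mx B) / (A * C - B ^+ 2) `^ (3 / 2)
  else - \det (conic_mx B) / (B ^+ 2 - A * C) `^ (3 / 2).

Definition cubic : {poly R} :=
  F *: 'X^3 - (4 * D * E) *: 'X^2
  + (3 * C * D ^+ 2 + 3 * A * E ^+ 2 - A * C * F) *: 'X
  - (2 * A * C * D * E)%:P.

End PencilConics.

(* Main.v *)
Require Import Defs.
From mathcomp Require Import all_boot all_order all_algebra ring lra.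
From mathcomp Require Import all_classical all_reals all_analysis.
Import Order.TTheory GRing.Theory Num.Theory.
Import numFieldNormedType.Exports.
Local Open Scope classical_set_scope.
Local Open Scope ring_scope.

(* Where B^2 > AC, the derivative of calA is - p(B) / (B^2 - AC)^(5/2), so a
   local maximum is a root of p at which p passes from negative to positive.
   At b = eps * sqrt(AC) one has p(b) = - 3 b det M(b) and
   A det M(b) = - (A E - b D)^2, while A times the equation of Q_b reads
   (A x + b y)^2 = - A (2 D x + 2 E y + F).  Hence p(b) = 0 exactly when the two
   linear forms are proportional, that is, when Q_b is a pair of parallel lines;
   otherwise q(x) := eps * p(eps * x) is negative at sqrt(AC), and, F being
   positive, it has a root beyond, where it changes sign.  Parabolas are told
   apart from pairs of lines by the fact that they contain no line. *)

(** * Lines contained in curves whose equation equates a squared affine form to an affine form *)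

Lemma sumr_sqr_gt0 (R : realDomainType) (u v : R) :
  (u, v) != (0, 0) -> 0 < u ^+ 2 + v ^+ 2.
Proof.
move=> uv0; rewrite lt0r addr_ge0 ?sqr_ge0// andbT paddr_eq0 ?sqr_ge0//.
by rewrite !sqrf_eq0; apply: contra uv0 => /andP[/eqP -> /eqP ->].
Qed.

(** Along the line, parametrized by [s] with direction [(- v, u)], the equation has degree at most 2
    in [s]. If it holds at [0], [1] and [-1], its coefficients vanish, so both linear forms kill the
    direction and are therefore proportional. *)
Lemma no_line_sub_parabola (R : realType) (l1 m1 n1 l2 m2 n2 u v w : R) :
  l1 * m2 != l2 * m1 -> (u, v) != (0, 0) ->
  ~ line u v w `<=` [set z | (l1 * z.1 + m1 * z.2 + n1) ^+ 2
                             = l2 * z.1 + m2 * z.2 + n2].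
Proof.
move=> lm uv0 sub; have q0 := sumr_sqr_gt0 _ _ _ uv0.
set q := _ + _ in q0; have qn0 : q != 0 by rewrite gt_eqF.
pose P s : R * R := (w * u / q - s * v, w * v / q + s * u).
have lineP s : line u v w (P s) by rewrite /line /P /= /q; field.
have sol s := sub _ (lineP s).
have := sol 0; have := sol 1; have := sol (-1).
rewrite /P /=; set x0 := w * u / q; set y0 := w * v / q => e3 e2 e1.
(* The second difference of the three equations isolates the square of [l1 * v - m1 * u]. *)
have dl : l1 * v = m1 * u.
  apply/eqP; rewrite -subr_eq0 -sqrf_eq0; apply/eqP; lra.
have dk : l2 * v = m2 * u.
  have E2 : (l1 * x0 + m1 * y0 + n1) ^+ 2
      = l2 * (x0 - 1 * v) + m2 * (y0 + 1 * u) + n2.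
    by rewrite -e2; congr (_ ^+ 2); lra.
  lra.
have lm' : l1 * m2 - l2 * m1 != 0 by rewrite subr_eq0.
have u0 : u = 0.
  apply: (mulfI lm'); rewrite mulr0 mulrBl -mulrA -dk.
  by rewrite -mulrA -dl; ring.
have v0 : v = 0.
  apply: (mulfI lm'); rewrite mulr0 mulrBl.
  have -> : l1 * m2 * v = m2 * (l1 * v) by ring.
  have -> : l2 * m1 * v = m1 * (l2 * v) by ring.
  by rewrite dl dk; ring.
by move: uv0; rewrite u0 v0 eqxx.
Qed.

(** * Reduction of a central conic to the standard hyperbola *)

(** Spectral theorem for the matrix with rows [(A, B)] and [(B, C)]: [k] is its larger eigenvalue,
    [kE] its characteristic equation, [(B, h)] an eigenvector (nonzero since [B != 0]), and the
    trace gives the other eigenvalue. *)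
Lemma sym2_diagonalization (R : rcfType) (A B C : R) : B != 0 ->
  exists u v k1 k2 : R,
    [/\ u ^+ 2 + v ^+ 2 = 1, k1 * u ^+ 2 + k2 * v ^+ 2 = A,
        (k1 - k2) * (u * v) = B, k1 * v ^+ 2 + k2 * u ^+ 2 = C
      & k1 * k2 = A * C - B ^+ 2].
Proof.
move=> B0; set S := Num.sqrt ((A - C) ^+ 2 + 4 * B ^+ 2).
have SE : S ^+ 2 = (A - C) ^+ 2 + 4 * B ^+ 2.
  by rewrite sqr_sqrtr//; have := sqr_ge0 (A - C); have := sqr_ge0 B; lra.
pose k := (A + C + S) / 2; pose h := k - A.
have kE : h * (k - C) = B ^+ 2 by rewrite /h /k; lra.
have n0 : 0 < B ^+ 2 + h ^+ 2.
  by apply: sumr_sqr_gt0; apply: contra B0 => /eqP[-> _].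
set n := Num.sqrt (B ^+ 2 + h ^+ 2).
have nE : n ^+ 2 = B ^+ 2 + h ^+ 2 by rewrite sqr_sqrtr// ltW.
have nn0 : n != 0 by rewrite gt_eqF// sqrtr_gt0.
have n20 : B ^+ 2 + h ^+ 2 != 0 by rewrite gt_eqF.
exists (B / n), (h / n), k, (A + C - k).
have div2 x y : x / n * (y / n) = x * y / (B ^+ 2 + h ^+ 2).
  by rewrite -nE; field.
(* The added multiple is zero by the characteristic equation, so [z] lets [ring] prove identities
   that hold only modulo [kE]. *)
have divN x y z : x = y * (B ^+ 2 + h ^+ 2) + h * z * (h * (k - C) - B ^+ 2) ->
    x / (B ^+ 2 + h ^+ 2) = y.
  by move=> ->; rewrite kE subrr mulr0 addr0 mulfK.
rewrite !expr2 !div2 -!expr2 !mulrA -!mulrDl; split.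
- by field.
- by apply: (divN _ _ (-1)); rewrite /h; ring.
- have -> : k - (A + C - k) = h + (k - C) by rewrite /h; ring.
  have -> : (h + (k - C)) * B * h = B * (B ^+ 2 + h ^+ 2) by rewrite -kE; ring.
  by rewrite mulfK.
- by apply: (divN _ _ 1); rewrite /h; ring.
- by rewrite -kE /h; ring.
Qed.

Lemma central_hyperbola_pos (R : realType) (o : R * R) (u v k1 k2 m : R) :
  u ^+ 2 + v ^+ 2 = 1 -> m != 0 -> 0 < m / k1 -> m / k2 < 0 ->
  is_hyperbola [set z | k1 * (u * (z.1 - o.1) + v * (z.2 - o.2)) ^+ 2
                      + k2 * (u * (z.2 - o.2) - v * (z.1 - o.1)) ^+ 2 = m].
Proof.
move=> uv m0 mk1 mk2.
have k10 : k1 != 0 by apply: contraTneq mk1 => ->; rewrite invr0 mulr0 ltxx.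
have k20 : k2 != 0 by apply: contraTneq mk2 => ->; rewrite invr0 mulr0 ltxx.
have mk2' : 0 < - (m / k2) by rewrite oppr_gt0.
exists o, u, v, (Num.sqrt (m / k1)), (Num.sqrt (- (m / k2))).
split; rewrite ?sqrtr_gt0//.
apply/seteqP; split=> z /=; rewrite !expr_div_n !sqr_sqrtr ?ltW//;
  set X := (_ + _) ^+ 2; set Y := (_ - _) ^+ 2 => zE.
  transitivity ((k1 * X + k2 * Y) / m); first by field; rewrite k10 k20 m0.
  by rewrite zE divff.
have -> : k1 * X + k2 * Y = m * (X / (m / k1) - Y / (- (m / k2))).
  by field; rewrite k10 k20 m0.
by rewrite zE mulr1.
Qed.

Lemma central_hyperbola (R : realType) (o : R * R) (u v k1 k2 m : R) :
  u ^+ 2 + v ^+ 2 = 1 -> k1 * k2 < 0 -> m != 0 ->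
  is_hyperbola [set z | k1 * (u * (z.1 - o.1) + v * (z.2 - o.2)) ^+ 2
                      + k2 * (u * (z.2 - o.2) - v * (z.1 - o.1)) ^+ 2 = m].
Proof.
move=> uv k12 m0.
have k10 : k1 != 0 by apply: contraTneq k12 => ->; rewrite mul0r ltxx.
have k20 : k2 != 0 by apply: contraTneq k12 => ->; rewrite mulr0 ltxx.
have mk1 : m / k1 != 0 by rewrite mulf_neq0 ?invr_eq0.
have mk12 : (m / k1) * (m / k2) < 0.
  have -> : m / k1 * (m / k2) = k1 * k2 * (m / (k1 * k2)) ^+ 2.
    by field; rewrite k10 k20.
  by rewrite nmulr_rlt0// exprn_even_gt0//= mulf_neq0 ?invr_eq0 ?mulf_neq0.
have [mk1gt|mk1le] := ltP 0 (m / k1).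
  by apply: central_hyperbola_pos; rewrite // -(pmulr_rlt0 _ mk1gt).
have mk1lt : m / k1 < 0 by rewrite lt_neqAle mk1.
have vu : (- v) ^+ 2 + u ^+ 2 = 1 by rewrite sqrrN addrC.
have mk2 : 0 < m / k2 by rewrite -(nmulr_rlt0 _ mk1lt).
(* When [m / k1 < 0], a quarter turn of the frame exchanges the two axes. *)
have := central_hyperbola_pos R o (- v) u k2 k1 m vu m0 mk2 mk1lt.
congr is_hyperbola; apply/seteqP.
by split=> z /= <-; ring.
Qed.

(** The expanded determinant of the symmetric matrix of a general conic. *)
Definition conic_det (R : realType) (A B C D E F : R) : R :=
  A * C * F + 2 * B * D * E - A * E ^+ 2 - C * D ^+ 2 - F * B ^+ 2.

Lemma hyperbola_of_detM (R : realType) (A B C D E F : R) :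
  B != 0 -> A * C < B ^+ 2 -> conic_det R A B C D E F != 0 ->
  is_hyperbola [set z : R * R | A * z.1 ^+ 2 + 2 * B * z.1 * z.2 + C * z.2 ^+ 2
                     + 2 * D * z.1 + 2 * E * z.2 + F = 0].
Proof.
move=> B0 ACB d0; have j0 : A * C - B ^+ 2 < 0 by rewrite subr_lt0.
have jn0 : A * C - B ^+ 2 != 0 by rewrite lt_eqF.
have [u [v [k1 [k2 [uv kA kB kC kj]]]]] := sym2_diagonalization R A B C B0.
(* The centre, where both partial derivatives vanish, by Cramer's rule. The left-hand side of the
   equation takes the value [- m] there. *)
pose o : R * R := ((B * E - C * D) / (A * C - B ^+ 2),
                   (B * D - A * E) / (A * C - B ^+ 2)).
pose m := - conic_det R A B C D E F / (A * C - B ^+ 2).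
have m0 : m != 0 by rewrite mulf_neq0 ?oppr_eq0 ?invr_eq0.
have hyp : k1 * k2 < 0 by rewrite kj.
have := central_hyperbola R o _ _ _ _ _ uv hyp m0.
congr is_hyperbola; apply/seteqP.
have key z : k1 * (u * (z.1 - o.1) + v * (z.2 - o.2)) ^+ 2
       + k2 * (u * (z.2 - o.2) - v * (z.1 - o.1)) ^+ 2 - m =
    A * z.1 ^+ 2 + 2 * B * z.1 * z.2 + C * z.2 ^+ 2
                     + 2 * D * z.1 + 2 * E * z.2 + F.
  transitivity (A * (z.1 - o.1) ^+ 2 + 2 * B * (z.1 - o.1) * (z.2 - o.2)
     + C * (z.2 - o.2) ^+ 2 - m); first by rewrite -kA -kB -kC; ring.
  by rewrite /m /o /conic_det /=; field.
split=> z /=; rewrite -key => /eqP; last by rewrite subr_eq0 => /eqP.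
by move=> zE; apply/eqP; rewrite subr_eq0.
Qed.

(** * Derivatives, maxima and the sign of a cubic *)

Lemma le_of_derivative_sign_change (R : realType) (f df : R -> R) (r x0 : R) :
  r < x0 -> (forall x, r < x -> is_derive x 1 f (df x)) ->
  (forall x, r < x -> x < x0 -> 0 <= df x) ->
  (forall x, x0 < x -> df x <= 0) ->
  forall x, r < x -> f x <= f x0.
Proof.
move=> rx0 fdf df_ge0 df_le0 x rx.
have mvt y z : r < y -> y < z ->
    exists2 c, c \in `]y, z[ & f z - f y = df c * (z - y).
  move=> ry yz; apply: MVT => // [t|].
    by rewrite in_itv /= => /andP[yt _]; exact/fdf/(lt_trans ry).
  apply: derivable_within_continuous => t.
  by rewrite in_itv /= => /andP[yt _]; have [] := fdf t (lt_le_trans ry yt).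
have [xx0|x0x|->//] := ltgtP x x0.
  have [c] := mvt _ _ rx xx0; rewrite in_itv /= => /andP[xc cx0] fE.
  by rewrite -subr_ge0 fE mulr_ge0 ?df_ge0 ?subr_ge0 ?(ltW xx0)// (lt_trans rx).
have [c] := mvt _ _ rx0 x0x; rewrite in_itv /= => /andP[x0c cx] fE.
by rewrite -subr_le0 fE mulr_le0_ge0 ?df_le0 ?subr_ge0 ?(ltW x0x).
Qed.

(** With [m] standing for [A * C] and [e] for [eps * D * E], the quotient is [calA] at [eps * y]
    outside the double directions, its numerator being minus the determinant. *)
Lemma is_derive_quadratic_div_powR (R : realType) (F e K m x : R) :
  0 < x ^+ 2 - m ->
  is_derive x 1
    (fun y => (F * y ^+ 2 - 2 * e * y - K) / (y ^+ 2 - m) `^ (3 / 2))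
    (- (F * x ^+ 3 - 4 * e * x ^+ 2 - (3 * K - 2 * m * F) * x - 2 * m * e)
       / (x ^+ 2 - m) `^ (5 / 2)).
Proof.
move=> x0.
pose g : R -> R := fun y => y ^+ 2 - m.
pose P : R -> R := fun y => F * y ^+ 2 - 2 * e * y - K.
have -> : (fun y => (F * y ^+ 2 - 2 * e * y - K) / (y ^+ 2 - m) `^ (3 / 2))
        = P * ((powR (R := R) ^~ (- (3 / 2))) \o g).
  by apply/funext => y; rewrite /P /g fctE /= powRN.
have dg : is_derive x 1 g (2 * x).
  apply: is_derive_eq; rewrite /GRing.scale /=; ring.
have dP : is_derive x 1 P (2 * F * x - 2 * e).
  apply: is_derive_eq; rewrite /GRing.scale /=; ring.
have dw := is_derive1_comp (is_derive1_powR (- (3 / 2)) (x0 : 0 < g x)) dg.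
have := is_deriveM dP dw.
move=> dPw; apply: (is_derive_eq dPw).
have -> : - (3 / 2) - 1 = - (5 / 2) :> R by field.
rewrite /= /g powRN -powRN.
(* Taking out the power [- (5 / 2)] leaves a polynomial identity. *)
have -> : - (3 / 2) = 1 + - (5 / 2) :> R by field.
rewrite powRD ?powRr1 ?(ltW x0) ?(gt_eqF x0) ?implybT// powRN.
rewrite /P /GRing.scale /=; field.
by rewrite gt_eqF ?powR_gt0.
Qed.

(* For [e >= 0] the cubic divided by [x ^+ 3] is increasing; for [e < 0] the
   cubic is convex on the positive half-line. *)
Lemma cubic_sign_change (R : realFieldType) (F e G m r x0 : R) :
  let q x := F * x ^+ 3 - 4 * e * x ^+ 2 + G * x - 2 * m * e in
  0 < F -> G < 0 -> 0 < m -> 0 < r -> r < x0 -> q r < 0 -> q x0 = 0 ->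
  (forall x, r < x -> x < x0 -> q x <= 0) /\ (forall x, x0 < x -> 0 <= q x).
Proof.
move=> q F0 G0 m0 r0 rx0 qr qx0; have x00 : 0 < x0 by exact: lt_trans rx0.
have [e0|e0] := leP 0 e.
  (* The difference of [q x / x ^+ 3] and [q x0 / x0 ^+ 3], cleared of denominators. *)
  have key x : x0 ^+ 3 * q x = (x - x0) *
      (4 * e * (x ^+ 2 * x0 ^+ 2) + (- G) * (x * x0 * (x + x0))
       + 2 * m * e * (x ^+ 2 + x * x0 + x0 ^+ 2)).
    have -> : x0 ^+ 3 * q x = x0 ^+ 3 * q x - x ^+ 3 * q x0.
      by rewrite qx0 mulr0 subr0.
    by rewrite /q; ring.
  have pos x : 0 < x -> 0 <= 4 * e * (x ^+ 2 * x0 ^+ 2)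
      + (- G) * (x * x0 * (x + x0)) + 2 * m * e * (x ^+ 2 + x * x0 + x0 ^+ 2).
    move=> xgt0; rewrite !addr_ge0 ?mulr_ge0 ?addr_ge0 ?sqr_ge0 ?ler0n//;
      rewrite ?oppr_ge0 ?mulr_ge0 ?ltW//.
  have x03 : 0 < x0 ^+ 3 by rewrite exprn_gt0.
  split=> [x rx xx0|x x0x].
    rewrite -(pmulr_rle0 _ x03) key mulr_le0_ge0 ?subr_le0 ?(ltW xx0)//.
    by rewrite pos// (lt_trans r0).
  rewrite -(pmulr_rge0 _ x03) key mulr_ge0 ?subr_ge0 ?(ltW x0x)//.
  by rewrite pos// (lt_trans x00).
(* Comparison of [q] with its chord through [r] and [x0]; the last factor is the second divided
   difference. *)
have key x : (x0 - r) * q x = (x0 - x) * q r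
    - (x - r) * (x0 - x) * (x0 - r) * (F * (x + r + x0) - 4 * e).
  have -> : (x0 - x) * q r = (x0 - x) * q r + (x - r) * q x0.
    by rewrite qx0 mulr0 addr0.
  by rewrite /q; ring.
have pos x : 0 < x -> 0 < F * (x + r + x0) - 4 * e.
  move=> xgt0; have : 0 < F * (x + r + x0) by rewrite mulr_gt0 ?addr_gt0.
  lra.
have x0r : 0 < x0 - r by rewrite subr_gt0.
split=> [x rx xx0|x x0x].
  have /pos px : 0 < x by exact: lt_trans rx.
  rewrite -(pmulr_rle0 _ x0r) key subr_le0 (@le_trans _ _ 0)//.
    by rewrite mulr_ge0_le0 ?subr_ge0 ?ltW.
  apply: mulr_ge0; last exact: ltW px.
  apply: mulr_ge0; last exact: ltW x0r.
  by rewrite mulr_ge0 ?subr_ge0 ?ltW.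
have /pos px : 0 < x by exact: lt_trans x0x.
rewrite -(pmulr_rge0 _ x0r) key subr_ge0 (@le_trans _ _ 0)//.
  rewrite mulr_le0_ge0 ?(ltW px)// mulr_le0_ge0 ?(ltW x0r)//.
  by rewrite mulr_ge0_le0 ?subr_ge0 ?subr_le0 ?ltW// (lt_trans rx0).
by apply: mulr_le0; [rewrite subr_le0 ltW | rewrite ltW].
Qed.

(** * Determinant and cubic in explicit form, and roots of a cubic *)

Lemma det_conic_mx (R : realType) (a b c d B : R) :
  \det (conic_mx a b c d B)
  = conic_det R (cfA c d) B (cfC a b) (cfD a b c d) (cfE a b c d) (cfF a b c d).
Proof.
rewrite (expand_det_row _ ord0) !big_ord_recl big_ord0 /cofactor.
rewrite !(expand_det_row _ ord0) !big_ord_recl !big_ord0 /cofactor !det_mx11.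
by rewrite !mxE /= /conic_det; ring.
Qed.

Lemma horner_cubic (R : realType) (a b c d B : R) :
  let A := cfA c d in let C := cfC a b in
  let D := cfD a b c d in let E := cfE a b c d in let F := cfF a b c d in
  (cubic a b c d).[B] = F * B ^+ 3 - 4 * D * E * B ^+ 2
    + (3 * C * D ^+ 2 + 3 * A * E ^+ 2 - A * C * F) * B - 2 * A * C * D * E.
Proof. by rewrite /cubic !hornerE. Qed.

Lemma cubic_root_gt (R : rcfType) (F G H I r : R) :
  let q x := F * x ^+ 3 - G * x ^+ 2 + H * x - I in
  0 < F -> q r < 0 -> exists2 x, r < x & q x = 0.
Proof.
move=> q F0 qr.
pose p := F *: 'X^3 - G *: 'X^2 + H *: 'X - I%:P.
have pE x : p.[x] = q x by rewrite /p /q !hornerE.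
pose s := `|G| + `|H| + `|I|.
have s0 : 0 <= s by rewrite !addr_ge0.
(* Since [M] is at least 1 and [F * M] at least [s], the cubic term dominates the three others at
   [M]. *)
pose M := 1 + `|r| + s / F.
have sF : 0 <= s / F by rewrite divr_ge0// ltW.
have M1 : 1 <= M by rewrite /M -addrA lerDl addr_ge0.
have M0 : 0 <= M by exact: le_trans M1.
have rM : r <= M.
  by rewrite /M; have := ler_norm r; lra.
have FM : s <= F * M.
  have -> : s = F * (s / F) by rewrite mulrC mulfVK ?gt_eqF.
  rewrite ler_wpM2l ?(ltW F0)// /M.
  by have := normr_ge0 r; lra.
have qM : 0 <= q M.
  have MM : M <= M ^+ 2 by rewrite expr2 ler_peMl.
  have M2 : 0 <= M ^+ 2 by rewrite sqr_ge0.
  have h1 : s * M ^+ 2 <= F * M ^+ 3.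
    by have -> : F * M ^+ 3 = F * M * M ^+ 2 by [ring]; rewrite ler_wpM2r.
  have h2 : G * M ^+ 2 <= `|G| * M ^+ 2 by rewrite ler_wpM2r// ler_norm.
  have h3 : - `|H| * M ^+ 2 <= H * M.
    apply: (@le_trans _ _ (- `|H| * M)).
      by rewrite !mulNr lerN2 ler_wpM2l.
    by rewrite ler_wpM2r// lerNl -normrN ler_norm.
  have h4 : I <= `|I| * M ^+ 2.
    by rewrite (le_trans (ler_norm I))// ler_peMr// (le_trans M1).
  by rewrite /q; move: h1; rewrite /s; lra.
have pr : p.[r] <= 0 <= p.[M] by rewrite !pE (ltW qr) qM.
have [x /andP[rx _] /rootP px] := poly_ivt rM pr.
exists x; last by rewrite -pE.
rewrite lt_neqAle rx andbT; apply: contraTneq qr => ->.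
by rewrite -pE px ltxx.
Qed.

Lemma parabola_no_line (R : realType) (S : set (R * R)) (u v w : R) :
  is_parabola S -> (u, v) != (0, 0) -> ~ line u v w `<=` S.
Proof.
move=> [ctr [p [q [k [pq k0 ->]]]]] uv0 sub.
(* The two linear forms of the standard equation are independent: their determinant is
   [- (4 * k)]. *)
have pqk : - q * (4 * k * q) != 4 * k * p * p.
  rewrite -subr_eq0; have -> : - q * (4 * k * q) - 4 * k * p * p = - (4 * k).
    by rewrite -[RHS]mulr1 -pq; ring.
  by rewrite oppr_eq0 mulf_neq0 ?pnatr_eq0 ?gt_eqF.
apply: (no_line_sub_parabola R (- q) p (q * ctr.1 - p * ctr.2) (4 * k * p)
  (4 * k * q) (- (4 * k * (p * ctr.1 + q * ctr.2))) u v w pqk uv0).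
move=> z /sub /=.
have -> : p * (z.2 - ctr.2) - q * (z.1 - ctr.1)
  = - q * z.1 + p * z.2 + (q * ctr.1 - p * ctr.2) by ring.
by move=> ->; ring.
Qed.

Section Pencil.
Variables (R : realType) (a b c d : R).
Hypotheses (hb : b < 0) (ha : 0 < a) (hd : d < 0) (hc : 0 < c).
Local Notation A := (cfA c d).
Local Notation C := (cfC a b).
Local Notation D := (cfD a b c d).
Local Notation E := (cfE a b c d).
Local Notation F := (cfF a b c d).
Local Notation Q := (conic a b c d).
Local Notation detM B := (conic_det R A B C D E F).

Lemma cfA_lt0 : A < 0. Proof. by rewrite /cfA pmulr_rlt0. Qed.

Lemma cfC_lt0 : C < 0. Proof. by rewrite /cfC pmulr_rlt0. Qed.

Lemma cfF_gt0 : 0 < F.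
Proof.
have -> : F = A * C by rewrite /cfF /cfA /cfC; ring.
by rewrite nmulr_rgt0 ?cfA_lt0 ?cfC_lt0.
Qed.

Let A0 : A != 0. Proof. by rewrite lt_eqF ?cfA_lt0. Qed.

(** * The conics with [B ^+ 2 = A * C]: parabola or parallel lines *)

Section DoubleDirection.
Variable B : R.
Hypothesis BAC : B ^+ 2 = A * C.

Lemma cfA_detM : A * detM B = - (A * E - B * D) ^+ 2.
Proof.
have -> : - (A * E - B * D) ^+ 2
  = - (A * E) ^+ 2 + 2 * A * E * B * D - B ^+ 2 * D ^+ 2 by ring.
by rewrite /conic_det BAC; ring.
Qed.

Lemma horner_cubic_detM : (cubic a b c d).[B] = - 3 * B * detM B.
Proof.
rewrite horner_cubic /conic_det.
have -> : B ^+ 3 = A * C * B by rewrite exprSr BAC.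
rewrite BAC; transitivity (3 * B * (C * D ^+ 2 + A * E ^+ 2)
  - 6 * D * E * (A * C)); first by ring.
by rewrite -BAC; ring.
Qed.

Lemma detM_eq0 : (detM B == 0) = (A * E == B * D).
Proof.
rewrite -[RHS]subr_eq0 -[RHS]sqrf_eq0 -[RHS]oppr_eq0 -cfA_detM.
by rewrite mulf_eq0 (negbTE A0).
Qed.

Lemma root_cubic_double_direction : root (cubic a b c d) B = (A * E == B * D).
Proof.
have B0 : B != 0.
  by rewrite -sqrf_eq0 BAC mulf_neq0 ?lt_eqF ?cfA_lt0 ?cfC_lt0.
rewrite /root horner_cubic_detM mulf_eq0 mulf_eq0 oppr_eq0 pnatr_eq0.
by rewrite (negbTE B0) detM_eq0.
Qed.

Lemma conicE_double_direction z : Q B z <->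
  (A * z.1 + B * z.2) ^+ 2 = - 2 * A * D * z.1 + - 2 * A * E * z.2 - A * F.
Proof.
rewrite /conic /=.
have key : A * (A * z.1 ^+ 2 + 2 * B * z.1 * z.2 + C * z.2 ^+ 2 + 2 * D * z.1
             + 2 * E * z.2 + F) = (A * z.1 + B * z.2) ^+ 2
   - (- 2 * A * D * z.1 + - 2 * A * E * z.2 - A * F).
  transitivity (A ^+ 2 * z.1 ^+ 2 + 2 * A * B * z.1 * z.2
     + A * C * z.2 ^+ 2 + 2 * A * D * z.1 + 2 * A * E * z.2 + A * F).
    by ring.
  by rewrite -BAC; ring.
split=> [zE|/eqP]; first by apply/eqP; rewrite -subr_eq0 -key zE mulr0.
by rewrite -subr_eq0 -key mulf_eq0 (negbTE A0) => /eqP.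
Qed.

Lemma conic_no_line (u v w : R) :
  A * E != B * D -> (u, v) != (0, 0) -> ~ line u v w `<=` Q B.
Proof.
move=> AEBD uv0 sub.
have nd : A * (- 2 * A * E) != - 2 * A * D * B.
  rewrite -subr_eq0.
  have -> : A * (- 2 * A * E) - - 2 * A * D * B = - 2 * A * (A * E - B * D).
    by ring.
  apply: mulf_neq0; last by rewrite subr_eq0.
  by apply: mulf_neq0 A0; rewrite oppr_eq0 pnatr_eq0.
apply: (no_line_sub_parabola R A B 0 _ _ (- (A * F)) u v w nd uv0).
by move=> z /sub /conicE_double_direction /=; rewrite addr0.
Qed.

(** With [L] for [A x + B y], the equation becomes [L ^+ 2 + 2 * D * L + A * F = 0]. Its reduced
    discriminant [D ^+ 2 - A * F] is positive because [A * F < 0], so the two lines are real and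
    distinct. *)
Lemma conic_parallel_line_pair :
  A * E = B * D -> is_parallel_line_pair (Q B).
Proof.
move=> AEBD; set s := Num.sqrt (D ^+ 2 - A * F).
have s20 : 0 < D ^+ 2 - A * F.
  by rewrite ltr_wpDl ?sqr_ge0// oppr_gt0 nmulr_rlt0 ?cfA_lt0 ?cfF_gt0.
have sE : s ^+ 2 = D ^+ 2 - A * F by rewrite sqr_sqrtr// ltW.
have s0 : 0 < s by rewrite sqrtr_gt0.
exists A, B, (- D + s), (- D - s); split.
- by apply: contra A0 => /eqP[-> _].
- by rewrite (inj_eq (addrI _)) -subr_eq0 opprK gt_eqF ?addr_gt0.
have key z : (A * z.1 + B * z.2) ^+ 2
    - (- 2 * A * D * z.1 + - 2 * A * E * z.2 - A * F)
  = (A * z.1 + B * z.2 - (- D + s)) * (A * z.1 + B * z.2 - (- D - s)).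
  have -> : - 2 * A * E = - 2 * B * D by rewrite -mulrA AEBD mulrA.
  have -> : A * F = D ^+ 2 - s ^+ 2 by rewrite sE; ring.
  by ring.
apply/seteqP; split=> z /=.
  move=> /conicE_double_direction /eqP; rewrite -subr_eq0 key mulf_eq0.
  by rewrite !subr_eq0 => /orP[]/eqP; [left|right].
move=> zl; apply/conicE_double_direction/eqP; rewrite -subr_eq0 key mulf_eq0.
by rewrite !subr_eq0; case: zl => ->; rewrite eqxx ?orbT.
Qed.

Lemma conic_parallel_line_pairP :
  is_parallel_line_pair (Q B) <-> A * E = B * D.
Proof.
split=> [[u [v [w1 [w2 [uv0 _ QE]]]]]|]; last exact: conic_parallel_line_pair.
apply/eqP; apply: contraT => AEBD.
by case: (conic_no_line u v w1 AEBD uv0); rewrite QE; left.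
Qed.

Lemma conic_parabola_neq : is_parabola (Q B) -> A * E != B * D.
Proof.
move=> parab; apply/eqP => /conic_parallel_line_pair.
move=> [u [v [w1 [w2 [uv0 _ QE]]]]].
by apply: (parabola_no_line R (Q B) u v w1 parab uv0); rewrite QE; left.
Qed.

End DoubleDirection.

(** * The range [A * C < B ^+ 2]: hyperbolas and the local maximum *)

(* [detM B = 0] together with [p(B) = 0] forces [F B = D E]; but the
   quadratic function [detM] is positive at its critical point [D E / F]. *)
Lemma detM_neq0_of_root (B : R) :
  A * C < B ^+ 2 -> root (cubic a b c d) B -> detM B != 0.
Proof.
move=> ACB /rootP; rewrite horner_cubic => p0; apply/eqP => detM0.
have vertex : F * B = D * E.
  have : 2 * (B ^+ 2 - A * C) * (F * B - D * E) = 0.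
    transitivity (- (3 * B * detM B) - (F * B ^+ 3 - 4 * D * E * B ^+ 2
      + (3 * C * D ^+ 2 + 3 * A * E ^+ 2 - A * C * F) * B
      - 2 * A * C * D * E)); first by rewrite /conic_det; ring.
    by rewrite p0 detM0; ring.
  move=> /eqP; rewrite !mulf_eq0 pnatr_eq0/= subr_eq0 (gt_eqF ACB)/=.
  by rewrite subr_eq0 => /eqP.
have ab : 0 < (a - b) ^+ 2 by rewrite exprn_gt0 ?subr_gt0 ?(lt_trans hb).
have cd : 0 < (c - d) ^+ 2 by rewrite exprn_gt0 ?subr_gt0 ?(lt_trans hd).
have : 0 < (A * F - D ^+ 2) * (C * F - E ^+ 2).
  have -> : (A * F - D ^+ 2) * (C * F - E ^+ 2)
    = (A * C / 4) ^+ 2 * ((a - b) ^+ 2 * (c - d) ^+ 2).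
    by rewrite /cfA /cfC /cfD /cfE /cfF; field.
  apply: mulr_gt0; last exact: mulr_gt0.
  by rewrite exprn_gt0// divr_gt0// nmulr_rgt0 ?cfA_lt0 ?cfC_lt0.
(* Completing the square: this product is [F * detM B + (F * B - D * E) ^+ 2]. *)
suff -> : (A * F - D ^+ 2) * (C * F - E ^+ 2) = 0 by rewrite ltxx.
transitivity (F * detM B + (F * B - D * E) ^+ 2);
  first by rewrite /conic_det; ring.
by rewrite vertex subrr detM0; ring.
Qed.

(** Writing the parameter as [eps * x] brings both outer branches of [calA] to one half-line; only
    the linear coefficient of the determinant feels the sign. *)
Lemma calA_outside (eps x : R) : eps ^+ 2 = 1 -> A * C < x ^+ 2 ->
  calA a b c d (eps * x) = (F * x ^+ 2 - 2 * (eps * D * E) * x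
    - (A * C * F - A * E ^+ 2 - C * D ^+ 2)) / (x ^+ 2 - A * C) `^ (3 / 2).
Proof.
move=> eps2 ACx; have sqr_epsx : (eps * x) ^+ 2 = x ^+ 2.
  by rewrite exprMn eps2 mul1r.
rewrite /calA sqr_epsx ltNge (ltW ACx)/=.
by rewrite det_conic_mx /conic_det sqr_epsx; congr (_ / _); ring.
Qed.

End Pencil.

Theorem mainTheorem3 (R : realType) (a b c d eps : R)
    (hb : b < 0) (ha : 0 < a) (hd : d < 0) (hc : 0 < c)
    (heps : eps = 1 \/ eps = -1) :
  let rAC : R := Num.sqrt (cfA c d * cfC a b) in
  (is_parabola (conic a b c d (eps * rAC)) ->
   exists B : R,
     [/\ root (cubic a b c d) B,
         rAC < eps * B,
         is_hyperbola (conic a b c d B) &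
         local_max_on (calA_dom a b c d) (calA a b c d) B]) /\
  (root (cubic a b c d) (eps * rAC) <->
   is_parallel_line_pair (conic a b c d (eps * rAC))).
Proof.
move=> r.
set A := cfA c d in r *; set C := cfC a b in r *.
set D := cfD a b c d; set E := cfE a b c d; set F := cfF a b c d.
have A0 : A < 0 by exact: cfA_lt0.
have C0 : C < 0 by exact: cfC_lt0.
have F0 : 0 < F by exact: cfF_gt0.
have eps2 : eps ^+ 2 = 1 by case: heps => ->; ring.
have eps_norm : `|eps| = 1 by case: heps => ->; rewrite ?normrN normr1.
have AC0 : 0 < A * C by rewrite nmulr_rgt0.
have r2 : r ^+ 2 = A * C by rewrite sqr_sqrtr// ltW.
have r0 : 0 < r by rewrite sqrtr_gt0.
have b2 : (eps * r) ^+ 2 = A * C by rewrite exprMn eps2 mul1r.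
have ltr_sqr x : r < x -> A * C < x ^+ 2.
  by move=> rx; rewrite -r2 ltrXn2r// ?nnegrE ltW// (lt_trans r0).
split; last first.
  split=> [|/conic_parallel_line_pairP AEBD].
    rewrite root_cubic_double_direction// => /eqP AEBD.
    exact/conic_parallel_line_pairP.
  by rewrite root_cubic_double_direction//; apply/eqP/AEBD.
move=> parab.
(* Here [- detM (eps * x)] is [F * x ^+ 2 - 2 * e * x - K], and [G] is the linear coefficient of the
   cubic rewritten through [K], as in the derivative formula. *)
pose e := eps * D * E.
pose K := A * C * F - A * E ^+ 2 - C * D ^+ 2.
pose G := 2 * (A * C) * F - 3 * K.
pose q x := F * x ^+ 3 - 4 * e * x ^+ 2 + G * x - 2 * (A * C) * e.
have epsq x : (cubic a b c d).[eps * x] = eps * q x.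
  rewrite horner_cubic -/A -/C -/D -/E -/F.
  have -> : (eps * x) ^+ 3 = eps * x ^+ 3.
    by rewrite exprMn exprS eps2 mulr1.
  have -> : eps * q x = eps * (F * x ^+ 3 + G * x)
    - eps ^+ 2 * (D * E * (4 * x ^+ 2 + 2 * (A * C))) by rewrite /q /e; ring.
  by rewrite exprMn eps2 /G /K; ring.
have qE x : q x = eps * (cubic a b c d).[eps * x].
  by rewrite epsq mulrA -expr2 eps2 mul1r.
have qr : q r < 0.
  rewrite qE horner_cubic_detM//.
  set det0 := conic_det _ _ _ _ _ _ _.
  have det00 : 0 < det0.
    have := cfA_detM R a b c d _ b2; rewrite -/det0 -/A => AdE.
    rewrite -(nmulr_rlt0 _ A0) AdE oppr_lt0 exprn_even_gt0//= subr_eq0.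
    exact: conic_parabola_neq parab.
  have -> : eps * (- 3 * (eps * r) * det0) = - (3 * r * det0) * eps ^+ 2 by ring.
  by rewrite eps2 mulr1 oppr_lt0 !mulr_gt0.
have G0 : G < 0.
  have -> : G = 3 * (A * E ^+ 2 + C * D ^+ 2) - A * C * F.
    by rewrite /G /K; ring.
  have := mulr_gt0 AC0 F0.
  have : A * E ^+ 2 <= 0 by rewrite mulr_le0_ge0 ?sqr_ge0 ?ltW.
  have : C * D ^+ 2 <= 0 by rewrite mulr_le0_ge0 ?sqr_ge0 ?ltW.
  lra.
have [x0 rx0 qx0] : exists2 x, r < x & q x = 0.
  exact: (@cubic_root_gt R F (4 * e) G (2 * (A * C) * e)).
have [qle qge] :=
  cubic_sign_change R F e G (A * C) r x0 F0 G0 AC0 r0 rx0 qr qx0.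
have root0 : root (cubic a b c d) (eps * x0) by rewrite /root epsq qx0 mulr0.
have ACx0 : A * C < (eps * x0) ^+ 2 by rewrite exprMn eps2 mul1r ltr_sqr.
exists (eps * x0); split=> //.
- by rewrite mulrA -expr2 eps2 mul1r.
- apply: hyperbola_of_detM => //; last exact: detM_neq0_of_root.
  by rewrite -sqrf_eq0 gt_eqF// (lt_trans AC0).
split; first by rewrite /calA_dom /= gt_eqF.
pose f x := (F * x ^+ 2 - 2 * e * x - K) / (x ^+ 2 - A * C) `^ (3 / 2).
pose df x := - q x / (x ^+ 2 - A * C) `^ (5 / 2).
have calAE x : r < x -> calA a b c d (eps * x) = f x.
  by move=> rx; rewrite calA_outside ?ltr_sqr.
have fdf x : r < x -> is_derive x 1 f (df x).
  move=> rx; have x2 : 0 < x ^+ 2 - A * C by rewrite subr_gt0 ltr_sqr.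
  have := is_derive_quadratic_div_powR R F e K (A * C) x x2.
  have <- : q x = F * x ^+ 3 - 4 * e * x ^+ 2
        - (3 * K - 2 * (A * C) * F) * x - 2 * (A * C) * e by rewrite /q /G; ring.
  by [].
have fmax : forall x, r < x -> f x <= f x0.
  apply: (le_of_derivative_sign_change R f df r x0 rx0 fdf) => x.
    by move=> rx xx0; rewrite divr_ge0 ?powR_ge0// oppr_ge0 qle.
  by move=> x0x; rewrite mulr_le0_ge0 ?invr_ge0 ?powR_ge0// oppr_le0 qge.
have xr0 : 0 < x0 - r by rewrite subr_gt0.
(* This radius keeps [eps * y] beyond [r], where [calA] agrees with [f] and [x0] is a global
   maximum. *)
apply/nbhs_ballP; exists (x0 - r) => //= y; rewrite /ball /= => xy _.
have -> : y = eps * (eps * y) by rewrite mulrA -expr2 eps2 mul1r.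
suff rey : r < eps * y by rewrite !calAE ?fmax.
have : `|x0 - eps * y| < x0 - r.
  have -> : x0 - eps * y = eps * (eps * x0 - y).
    by rewrite mulrBr mulrA -expr2 eps2 mul1r.
  by rewrite normrM eps_norm mul1r.
by move=> /ltr_normlP[]; lra.
Qed.
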